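(* Let $A$ and $B$ be two finite dimensional algebras (of infinite global dimension) over a field $k$, and let $({}_AM_B,{}_BN_A)$ define a singular equivalence of Morita type in the sense of Chen and Sun between $A$ and $B$. If $A$ is self-injective, then so is $B$.
   Context: Singular equivalence of Morita type in the sense of Chen and Sun: a pair $(M,N)$ of an $A$-$B$-bimodule $M$ and a $B$-$A$-bimodule $N$ (with $k$ acting centrally) such that (1) $M$ is finitely generated projective as a left $A$-module and as a right $B$-module; (2) $N$ is finitely generated projective as a left $B$-module and as a right $A$-module; (3) there are bimodule isomorphisms $M\otimes_BN\cong A\oplus P$, where $P$ is finitely presented and of finite projective dimension as an $A$-$A$-bimodule, and $N\otimes_AM\cong B\oplus Q$, where $Q$ is finitely presented and of finite projective dimension as a $B$-$B$-bimodule. *)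

(* Defs.v *)
From HB Require Import structures.
From mathcomp Require Import all_boot all_order all_algebra all_field.

Set Implicit Arguments.
Unset Strict Implicit.
Unset Printing Implicit Defensive.

Import GRing.Theory.
Local Open Scope ring_scope.

Reserved Notation "v <* b" (at level 40, left associativity).

Definition surjective_fun (X Y : Type) (f : X -> Y) := forall y, exists x, f x = y.

Definition exact_at (X Y : Type) (Z : zmodType) (f : X -> Y) (g : Y -> Z) :=
  forall y, g y = 0 <-> exists x, f x = y.

(* One-sided modules. A left module over R is an lmodType R; a right module   *)
(* is a left module over the converse ring R^c.                               *)

Definition mod_fg (R : nzRingType) (V : lmodType R) :=
  exists (n : nat) (s : 'I_n -> V),
    forall v, exists a : 'I_n -> R, v = \sum_i a i *: s i.

Definition mod_projective (R : nzRingType) (P : lmodType R) :=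
  forall (X Y : lmodType R) (p : {linear X -> Y}) (f : {linear P -> Y}),
    surjective_fun p -> exists g : {linear P -> X}, forall x, p (g x) = f x.

Definition mod_injective (R : nzRingType) (E : lmodType R) :=
  forall (X Y : lmodType R) (i : {linear X -> Y}) (f : {linear X -> E}),
    injective i -> exists g : {linear Y -> E}, forall x, g (i x) = f x.

(* Self-injectivity and global dimension are taken on left modules; for a      *)
(* finite dimensional algebra both agree with their right-hand versions.      *)
Definition selfinjective (R : nzRingType) := mod_injective (R^o : lmodType R).

(* The projective resolution 0 -> P n -> ... -> P 0 -> X -> 0 is extended by  *)
(* zero modules beyond n.                                                     *)
Definition mod_pd_le (R : nzRingType) (X : lmodType R) (n : nat) :=
  exists (P : nat -> lmodType R) (d : forall i, {linear P i.+1 -> P i})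
         (e : {linear P 0%N -> X}),
    [/\ forall i, mod_projective (P i),
        forall i, (n < i)%N -> forall x : P i, x = 0,
        surjective_fun e,
        exact_at (d 0%N) e &
        forall i, exact_at (d i.+1) (d i)].

Definition infinite_gldim (R : nzRingType) :=
  ~ exists n, forall X : lmodType R, mod_pd_le X n.

(* A-B-bimodules on which k acts centrally. *)

HB.mixin Record Lmodule_isBimodule (k : fieldType) (A B : algType k) V
    of GRing.Lmodule A V := {
  rscale : V -> B -> V;
  rscaleDl : forall b, {morph rscale^~ b : u v / u + v};
  rscaleDr : forall v, {morph rscale v : b c / b + c};
  rscale1 : forall v, rscale v 1 = v;
  rscaleM : forall v b c, rscale v (b * c) = rscale (rscale v b) c;
  rscaleZ : forall (a : A) v b, rscale (a *: v) b = a *: rscale v b;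
  rscale_central : forall (c : k) v, rscale v c%:A = (c%:A : A) *: v
}.

#[short(type="bimodType")]
HB.structure Definition Bimodule (k : fieldType) (A B : algType k) :=
  { V of GRing.Lmodule A V & Lmodule_isBimodule k A B V }.

Arguments rscale {k A B s} v b.
Notation "v <* b" := (rscale v b) : ring_scope.

Section RightModule.
Variables (k : fieldType) (A B : algType k).

(* The underlying right B-module of an A-B-bimodule. *)
Definition rmod (V : bimodType A B) : Type := V.

Variable V : bimodType A B.
HB.instance Definition _ := GRing.Zmodule.on (rmod V).

Let scale (b : B^c) (v : rmod V) : rmod V := (v : V) <* (b : B).

Fact rmod_scaleA b c v : scale b (scale c v) = scale (b * c) v.
Proof. by rewrite /scale -rscaleM. Qed.

Fact rmod_scale1 : left_id 1 scale.
Proof. by move=> v; apply: rscale1. Qed.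

Fact rmod_scaleDr : right_distributive scale +%R.
Proof. by move=> b u v; apply: rscaleDl. Qed.

Fact rmod_scaleDl v : {morph scale^~ v : b c / b + c}.
Proof. by move=> b c; apply: rscaleDr. Qed.

HB.instance Definition _ := GRing.Zmodule_isLmodule.Build B^c (rmod V)
  rmod_scaleA rmod_scale1 rmod_scaleDr rmod_scaleDl.
End RightModule.

Section RegularBimodule.
Variables (k : fieldType) (A : algType k).

Let act (v : A^o) (b : A) : A^o := (v : A) * b.

Fact reg_rscaleDl b : {morph act^~ b : u v / u + v}.
Proof. by move=> u v; apply: mulrDl. Qed.

Fact reg_rscaleDr v : {morph act v : b c / b + c}.
Proof. by move=> b c; apply: mulrDr. Qed.

Fact reg_rscale1 v : act v 1 = v.
Proof. exact: mulr1. Qed.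

Fact reg_rscaleM v b c : act v (b * c) = act (act v b) c.
Proof. exact: mulrA. Qed.

Fact reg_rscaleZ (a : A) v b : act (a *: v) b = a *: act v b.
Proof. exact/esym/mulrA. Qed.

Fact reg_rscale_central (c : k) v : act v c%:A = (c%:A : A) *: v.
Proof. by rewrite -[RHS]/(c%:A * (v : A)) /act mulr_algr mulr_algl. Qed.

HB.instance Definition _ := Lmodule_isBimodule.Build k A A A^o
  reg_rscaleDl reg_rscaleDr reg_rscale1 reg_rscaleM reg_rscaleZ
  reg_rscale_central.
End RegularBimodule.

Section DirectSum.
Variables (k : fieldType) (A B : algType k) (U V : bimodType A B).

Let act (w : U * V) (b : B) : U * V := (w.1 <* b, w.2 <* b).

Fact sum_rscaleDl b : {morph act^~ b : u v / u + v}.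
Proof. by move=> u v; rewrite /act /= !rscaleDl. Qed.

Fact sum_rscaleDr w : {morph act w : b c / b + c}.
Proof. by move=> b c; rewrite /act !rscaleDr. Qed.

Fact sum_rscale1 w : act w 1 = w.
Proof. by case: w => u v; rewrite /act !rscale1. Qed.

Fact sum_rscaleM w b c : act w (b * c) = act (act w b) c.
Proof. by rewrite /act !rscaleM. Qed.

Fact sum_rscaleZ (a : A) w b : act (a *: w) b = a *: act w b.
Proof. by rewrite /act /= !rscaleZ. Qed.

Fact sum_rscale_central (c : k) w : act w c%:A = (c%:A : A) *: w.
Proof. by rewrite /act !rscale_central. Qed.

HB.instance Definition _ := Lmodule_isBimodule.Build k A B (U * V)%type
  sum_rscaleDl sum_rscaleDr sum_rscale1 sum_rscaleM sum_rscaleZ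
  sum_rscale_central.
End DirectSum.

Section Bimodules.
Variables (k : fieldType) (A B : algType k).
Implicit Types U V X Y P : bimodType A B.

(* A bimodule homomorphism is a left linear map that is also right linear. *)
Definition right_linear U V (f : U -> V) := forall u b, f (u <* b) = f u <* b.

Definition bimod_iso U V :=
  exists f : {linear U -> V}, right_linear f /\ bijective f.

Definition bimod_projective P :=
  forall X Y (p : {linear X -> Y}) (f : {linear P -> Y}),
    right_linear p -> right_linear f -> surjective_fun p ->
    exists g : {linear P -> X}, right_linear g /\ forall x, p (g x) = f x.

Definition bimod_pd_le X (n : nat) :=
  exists (P : nat -> bimodType A B) (d : forall i, {linear P i.+1 -> P i})
         (e : {linear P 0%N -> X}),
    (right_linear e /\ forall i, right_linear (d i)) /\
    [/\ forall i, bimod_projective (P i),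
        forall i, (n < i)%N -> forall x : P i, x = 0,
        surjective_fun e,
        exact_at (d 0%N) e &
        forall i, exact_at (d i.+1) (d i)].

Definition bimod_finite_pd X := exists n, bimod_pd_le X n.

(* F is free on the basis s, i.e. isomorphic to a direct sum of n copies of   *)
(* the free bimodule of rank one, whose underlying space is the tensor        *)
(* product of A and B over k.                                                 *)
Definition bimod_free_on (F : bimodType A B) (n : nat) (s : 'I_n -> F) :=
  forall X (x : 'I_n -> X),
    exists f : {linear F -> X}, [/\ right_linear f, forall i, f (s i) = x i &
      forall g : {linear F -> X},
        right_linear g -> (forall i, g (s i) = x i) -> g =1 f].

Definition bimod_fg_free (F : bimodType A B) :=
  exists (n : nat) (s : 'I_n -> F), bimod_free_on s.

Definition bimod_finitely_presented X :=
  exists (F1 F0 : bimodType A B) (d : {linear F1 -> F0}) (e : {linear F0 -> X}),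
    [/\ bimod_fg_free F1 /\ bimod_fg_free F0,
        right_linear d /\ right_linear e,
        exact_at d e &
        surjective_fun e].

End Bimodules.

Section TensorProduct.
Variables (k : fieldType) (A B C : algType k).
Variables (M : bimodType A B) (N : bimodType B C).

Definition balanced (Z : zmodType) (f : M -> N -> Z) :=
  [/\ forall m m' n, f (m + m') n = f m n + f m' n,
      forall m n n', f m (n + n') = f m n + f m n' &
      forall m b n, f (m <* b) n = f m (b *: n)].

(* The A-C-bimodule T, with t m n for the pure tensor of m and n, is the      *)
(* tensor product of M and N over B: t is the universal balanced map into an  *)
(* abelian group, and A and C act on T through M and N.                       *)
Definition is_tensor (T : bimodType A C) (t : M -> N -> T) :=
  [/\ balanced t,
      forall a m n, t (a *: m) n = a *: t m n,
      forall m n c, t m (n <* c) = t m n <* c &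
      forall (Z : zmodType) (f : M -> N -> Z), balanced f ->
        exists g : {additive T -> Z}, (forall m n, g (t m n) = f m n) /\
          forall h : {additive T -> Z},
            (forall m n, h (t m n) = f m n) -> h =1 g].

Definition tensor_iso (X : bimodType A C) :=
  exists (T : bimodType A C) (t : M -> N -> T), is_tensor t /\ bimod_iso T X.

End TensorProduct.

Definition singular_equivalence_Morita (k : fieldType) (A B : algType k)
    (M : bimodType A B) (N : bimodType B A) :=
  [/\ [/\ mod_fg M, mod_projective M,
          mod_fg (rmod M : lmodType B^c) &
          mod_projective (rmod M : lmodType B^c)],
      [/\ mod_fg N, mod_projective N,
          mod_fg (rmod N : lmodType A^c) &
          mod_projective (rmod N : lmodType A^c)],
      exists P : bimodType A A,
        [/\ tensor_iso M N (A^o * P)%type,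
            bimod_finitely_presented P & bimod_finite_pd P] &
      exists Q : bimodType B B,
        [/\ tensor_iso N M (B^o * Q)%type,
            bimod_finitely_presented Q & bimod_finite_pd Q]].

(* Main.v *)
From HB Require Import structures.
From mathcomp Require Import boolp functions.
Require Import Defs.
From mathcomp Require Import all_boot all_order all_algebra all_field.

Set Implicit Arguments.
Unset Strict Implicit.
Unset Printing Implicit Defensive.

Import GRing.Theory.
Local Open Scope ring_scope.

(** Write [ev] for the projection of [N (x)_A M] onto its summand [B], and [u]
for the preimage of [1].  As [ev] is a bimodule map and [u] commutes with [B],
the module [B] turns out to be a direct summand of a finite power of the left
[B]-module [Hom_A(M, A)], which is injective; hence [B] is self-injective.
- [Hom_A(M, A)] is injective because [Hom_B(Y, Hom_A(M, A))] is
  [Hom_A(M (x)_B Y, A)], where [M (x)_B -] is exact, [M] being projective on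
  the right, and [Hom_A(-, A)] is exact, [A] being self-injective
  ([balanced_form_extends]).
- Let [s], [c] be a dual basis of [M] over [A]: [m = \sum_j c j m *: s j].  The
  inclusion of [B] sends [b] to the maps [m |-> c j (m b)].  The retraction
  sends a family [phi] to the value at [u] of the map
  [n (x) m |-> \sum_j ev (n (phi j m) (x) s j)]; if [phi] comes from [b], this
  map is [n (x) m |-> ev (n (x) m) b], whose value at [u] is [b].
In [selfinjective_of_split_evaluation] inclusion, extension along an
injection [X -> Y] and retraction are performed at once, starting from a map
[X -> B]. *)

(** * Dual bases *)

Lemma fg_projective_dual_basis (R : nzRingType) (V : lmodType R) :
  mod_fg V -> mod_projective V ->
  exists (n : nat) (s : 'I_n -> V) (c : 'I_n -> {linear V -> R^o}),
    forall v, v = \sum_i (c i v : R) *: s i.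
Proof.
move=> [n [s gen_s]] projV.
pose p (r : 'rV[R]_n) : V := \sum_i r 0 i *: s i.
have p_lin : linear p.
  move=> a x y; rewrite /p scaler_sumr -big_split; apply: eq_bigr => i _ /=.
  by rewrite !mxE scalerDl scalerA.
pose pL : {linear 'rV[R]_n -> V} :=
  HB.pack p (GRing.isLinear.Build R 'rV[R]_n V *:%R p p_lin).
have pS : surjective_fun pL.
  move=> v; have [a ->] := gen_s v; exists (\row_i a i).
  by apply: eq_bigr => i _; rewrite mxE.
have [g gK] := projV _ _ pL idfun pS.
have coord_lin i : linear (fun v => (g v) 0 i : R^o).
  by move=> a u v; rewrite linearP !mxE.
pose c i : {linear V -> R^o} := HB.pack (fun v => (g v) 0 i : R^o)
  (GRing.isLinear.Build R V R^o *:%R _ (coord_lin i)).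
exists n, s, c.
by move=> v; rewrite -{1}[v]gK.
Qed.

(** A structure rather than an existential, because the tensor product built
from it below must determine it for the module instances to be inferred. *)
Record right_dual_basis (k : fieldType) (A B : algType k) (M : bimodType A B) :=
  RightDualBasis {
    rdb_size : nat;
    rdb_elt : 'I_rdb_size -> M;
    rdb_coord : 'I_rdb_size -> M -> B;
    rdb_coordD : forall i, {morph rdb_coord i : u v / u + v};
    rdb_coordM : forall i m b, rdb_coord i (m <* b) = rdb_coord i m * b;
    rdb_span : forall m, m = \sum_i rdb_elt i <* rdb_coord i m
  }.
Arguments rdb_elt {k A B M} r i.
Arguments rdb_coord {k A B M} r i m.
Arguments rdb_coordD {k A B M} r i.

Lemma right_dual_basis_exists (k : fieldType) (A B : algType k)
    (M : bimodType A B) :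
  mod_fg (rmod M : lmodType B^c) -> mod_projective (rmod M : lmodType B^c) ->
  inhabited (right_dual_basis M).
Proof.
move=> fgM projM; have [n [s [c sc]]] := fg_projective_dual_basis fgM projM.
apply: inhabits; apply: (@RightDualBasis k A B M n s (fun i (m : M) => c i m : B)).
- by move=> i u v; rewrite (raddfD (c i)).
- by move=> i m b; exact: (linearZ_LR (c i) (b : B^c) (m : rmod M)).
- exact: sc.
Qed.

Lemma additive_sum (U V : zmodType) (f : U -> V) :
  {morph f : u v / u + v} -> forall (I : finType) (F : I -> U),
  f (\sum_i F i) = \sum_i f (F i).
Proof.
move=> fD I F; apply: (big_morph f fD).
by apply: (addrI (f 0)); rewrite -fD !addr0.
Qed.

(** * Tensoring with a finitely generated projective module *)

Section TensorModule.
Variables (k : fieldType) (A B : algType k) (M : bimodType A B).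
Variables (D : right_dual_basis M) (Y : lmodType B).

Local Notation n := (rdb_size D).
Local Notation coord := (rdb_coord D).
Local Notation elt := (rdb_elt D).

(** With [elt], [coord] a dual basis of [M] as a right [B]-module, [M] is a
summand of [B^n] through its coordinates, so [M (x)_B Y] is a summand of [Y^n];
this is the image of [m (x) y] there. *)
Definition coords_tensor (m : M) (y : Y) : {ffun 'I_n -> Y} :=
  [ffun i => coord i m *: y].

(** [v] stands for [\sum_j elt j (x) v j], which [a] multiplies on the left.
This action on [Y^n] is not unital: [1] acts as the idempotent that projects
[Y^n] onto [M (x)_B Y]. *)
Definition coords_act (a : A) (v : {ffun 'I_n -> Y}) : {ffun 'I_n -> Y} :=
  \sum_j coords_tensor (a *: elt j) (v j).

Lemma coords_actE a v i :
  coords_act a v i = \sum_j coord i (a *: elt j) *: v j.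
Proof. by rewrite /coords_act sum_ffunE; apply: eq_bigr => j _; rewrite ffunE. Qed.

Lemma coords_act_tensor a m y :
  coords_act a (coords_tensor m y) = coords_tensor (a *: m) y.
Proof.
apply/ffunP => i; rewrite coords_actE ffunE.
under eq_bigr => j _ do
  rewrite ffunE scalerA -rdb_coordM rscaleZ.
by rewrite -scaler_suml -(additive_sum (rdb_coordD D i)) -scaler_sumr -rdb_span.
Qed.

Lemma coords_actD a : {morph coords_act a : u v / u + v}.
Proof.
move=> u v; apply/ffunP => i; rewrite ffunE !coords_actE -big_split /=.
by apply: eq_bigr => j _; rewrite ffunE scalerDr.
Qed.

Lemma coords_actDl v : {morph coords_act^~ v : a b / a + b}.
Proof.
move=> a b; apply/ffunP => i; rewrite ffunE !coords_actE -big_split /=.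
by apply: eq_bigr => j _; rewrite scalerDl rdb_coordD scalerDl.
Qed.

Lemma coords_actM a b v : coords_act a (coords_act b v) = coords_act (a * b) v.
Proof.
rewrite {2}/coords_act (additive_sum (@coords_actD a)).
by apply: eq_bigr => j _; rewrite coords_act_tensor scalerA.
Qed.

Definition coords_fixed : {pred {ffun 'I_n -> Y}} :=
  fun v => coords_act 1 v == v.

Fact coords_fixed_zmod : zmod_closed coords_fixed.
Proof.
have act0 a : coords_act a 0 = 0.
  by apply: (addrI (coords_act a 0)); rewrite -coords_actD !addr0.
split=> [|u v]; first by rewrite unfold_in act0.
rewrite !unfold_in => /eqP uE /eqP vE.
by apply/eqP/(addIr v); rewrite -{2}vE -coords_actD !subrK.
Qed.

HB.instance Definition _ :=
  GRing.isZmodClosed.Build {ffun 'I_n -> Y} coords_fixed coords_fixed_zmod.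

(** [M (x)_B Y]. *)
Record tensor := Tensor {
  tensor_val :> {ffun 'I_n -> Y};
  _ : tensor_val \in coords_fixed }.
HB.instance Definition _ := [isSub for tensor_val].
HB.instance Definition _ := [Choice of tensor by <:].
HB.instance Definition _ := [SubChoice_isSubZmodule of tensor by <:].

Fact coords_act_fixed a v : coords_act a v \in coords_fixed.
Proof. by rewrite unfold_in coords_actM mul1r. Qed.

Let scale (a : A) (v : tensor) : tensor := Tensor (coords_act_fixed a (val v)).

Fact tensor_scaleA a b v : scale a (scale b v) = scale (a * b) v.
Proof. by apply: val_inj; rewrite /= coords_actM. Qed.

Fact tensor_scale1 : left_id 1 scale.
Proof. by move=> v; apply: val_inj; apply/eqP; apply: (valP v). Qed.

Fact tensor_scaleDr : right_distributive scale +%R.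
Proof. by move=> a u v; apply: val_inj; rewrite /= coords_actD. Qed.

Fact tensor_scaleDl v : {morph scale^~ v : a b / a + b}.
Proof. by move=> a b; apply: val_inj; rewrite /= coords_actDl. Qed.

HB.instance Definition _ := GRing.Zmodule_isLmodule.Build A tensor
  tensor_scaleA tensor_scale1 tensor_scaleDr tensor_scaleDl.

Fact pure_fixed m y : coords_tensor m y \in coords_fixed.
Proof. by rewrite unfold_in coords_act_tensor scale1r. Qed.

Definition pure m y : tensor := Tensor (pure_fixed m y).

Lemma pureDl y : {morph pure^~ y : m m' / m + m'}.
Proof.
by move=> m m'; apply/val_inj/ffunP => i; rewrite !ffunE rdb_coordD scalerDl.
Qed.

Lemma pureDr m : {morph pure m : y y' / y + y'}.
Proof. by move=> y y'; apply/val_inj/ffunP => i; rewrite !ffunE scalerDr. Qed.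

Lemma pureZ a m y : pure (a *: m) y = a *: pure m y.
Proof. by apply: val_inj; rewrite /= coords_act_tensor. Qed.

Lemma pure_balanced m b y : pure (m <* b) y = pure m (b *: y).
Proof. by apply/val_inj/ffunP => i; rewrite !ffunE rdb_coordM scalerA. Qed.

End TensorModule.

(** * Injectivity of the dual of M *)

Section BalancedForms.
Variables (k : fieldType) (A B : algType k) (M : bimodType A B).

(** These are the [A]-linear maps [M (x)_B Y -> A], or equally the [B]-linear
maps [Y -> Hom_A(M, A)]. *)
Definition balanced_form (Y : lmodType B) (f : M -> Y -> A) :=
  [/\ forall y, {morph f^~ y : m m' / m + m'},
      forall m, {morph f m : y y' / y + y'},
      forall a m y, f (a *: m) y = a * f m y &
      forall m b y, f (m <* b) y = f m (b *: y)].

(** In other words, the left [B]-module [Hom_A(M, A)] is injective.  On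
coordinates, [M (x)_B i] is [i] applied to each entry, hence injective, and
self-injectivity of [A] extends along it the linear map that [f] induces. *)
Lemma balanced_form_extends (X Y : lmodType B) (i : {linear X -> Y})
    (f : M -> X -> A) :
  mod_fg (rmod M : lmodType B^c) -> mod_projective (rmod M : lmodType B^c) ->
  selfinjective A -> injective i -> balanced_form f ->
  exists2 g : M -> Y -> A, balanced_form g & forall m x, g m (i x) = f m x.
Proof.
move=> fgM projM injA i_inj [fDl fDr fZ fb].
have iD : {morph i : x x' / x + x'} by exact: raddfD.
have iZ b x : i (b *: x) = b *: i x by exact: linearZ_LR.
have [D] := right_dual_basis_exists fgM projM.
(* [TiL] is [M (x)_B i]. *)
have map_fixed (v : tensor D X) : [ffun s => i (val v s)] \in @coords_fixed _ _ _ _ D Y.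
  rewrite unfold_in; apply/eqP/ffunP => s; rewrite coords_actE !ffunE.
  have /eqP/ffunP/(_ s) := valP v; rewrite coords_actE => vE; rewrite -[in RHS]vE.
  by rewrite (additive_sum iD); apply: eq_bigr => j _; rewrite ffunE iZ.
pose Ti (v : tensor D X) : tensor D Y := Tensor (map_fixed v).
have Ti_lin : linear Ti.
  move=> a u v; apply/val_inj/ffunP => s; rewrite !ffunE !coords_actE iD.
  rewrite (additive_sum iD); congr (_ + _).
  by apply: eq_bigr => j _; rewrite ffunE iZ.
pose TiL : {linear tensor D X -> tensor D Y} :=
  HB.pack Ti (GRing.isLinear.Build A _ _ *:%R Ti Ti_lin).
have TiL_inj : injective TiL.
  move=> u v /(congr1 val)/ffunP uv; apply/val_inj/ffunP => s.
  by have := uv s; rewrite !ffunE => /i_inj.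
(* The linear map [M (x)_B X -> A] induced by [f], since [v] stands for
   [\sum_s elt s (x) v s]. *)
pose fT (v : tensor D X) : A^o := \sum_s f (rdb_elt D s) (val v s).
have fT_lin : linear fT.
  move=> a u v; rewrite /fT.
  under eq_bigr => s _ do rewrite ffunE fDr coords_actE (additive_sum (fDr _)).
  rewrite big_split /=; congr (_ + _).
  rewrite exchange_big scaler_sumr; apply: eq_bigr => j _ /=.
  under eq_bigr => s _ do rewrite -fb.
  by rewrite -(additive_sum (fDl _)) -rdb_span fZ.
pose fTL : {linear tensor D X -> A^o} :=
  HB.pack fT (GRing.isLinear.Build A _ _ *:%R fT fT_lin).
have [g gE] := injA _ _ TiL fTL TiL_inj.
exists (fun m y => g (pure D m y)).
  split=> [y m m'|m y y'|a m y|m b y].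
  - by rewrite pureDl raddfD.
  - by rewrite pureDr raddfD.
  - by rewrite pureZ linearZ_LR.
  - by rewrite pure_balanced.
move=> m x; have -> : pure D m (i x) = TiL (pure D m x).
  by apply/val_inj/ffunP => s; rewrite !ffunE iZ.
rewrite gE /= /fT.
under eq_bigr => s _ do rewrite ffunE -fb.
by rewrite -(additive_sum (fDl _)) -rdb_span.
Qed.

End BalancedForms.

(** * Splitting off the regular module *)

(** Additivity is a hypothesis rather than bundled with the maps, so that the
lemma applies directly to composites with scalings and evaluations. *)
Lemma tensor_ext (k : fieldType) (A B C : algType k) (M : bimodType A B)
    (N : bimodType B C) (T : bimodType A C) (t : M -> N -> T) (Z : zmodType)
    (g h : T -> Z) :
  is_tensor t ->
  {morph g : x y / x + y} -> {morph h : x y / x + y} ->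
  (forall m n, g (t m n) = h (t m n)) -> g =1 h.
Proof.
move=> [[tDl tDr tb] _ _ tU] gD hD gh.
have bal : balanced (fun m n => h (t m n)).
  by split=> *; rewrite ?tDl ?tDr ?hD ?tb.
have [f [_ f_uniq]] := tU Z _ bal.
have nmodM (q : T -> Z) : {morph q : x y / x + y} -> nmod_morphism q.
  by move=> qD; split=> //; apply: (addrI (q 0)); rewrite -qD !addr0.
pose gA : {additive T -> Z} :=
  HB.pack g (GRing.isNmodMorphism.Build T Z g (nmodM g gD)).
pose hA : {additive T -> Z} :=
  HB.pack h (GRing.isNmodMorphism.Build T Z h (nmodM h hD)).
move=> x; have /= -> := f_uniq gA gh x.
by have /= -> := f_uniq hA (fun _ _ => erefl) x.
Qed.

(** [ev] and [u] exhibit [B] as a summand of [N (x)_A M] as a bimodule. *)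
Lemma selfinjective_of_split_evaluation (k : fieldType) (A B : algType k)
    (M : bimodType A B) (N : bimodType B A) (T : bimodType B B)
    (t : N -> M -> T) (ev : {linear T -> B^o}) (u : T) :
  mod_fg M -> mod_projective M ->
  mod_fg (rmod M : lmodType B^c) -> mod_projective (rmod M : lmodType B^c) ->
  is_tensor t -> right_linear ev -> ev u = 1 ->
  (forall b : B, b *: u = u <* b) ->
  selfinjective A -> selfinjective B.
Proof.
move=> fgM projM fgM' projM' tT evR evu cu injA X Y i f i_inj.
have [n [s [c sc]]] := fg_projective_dual_basis fgM projM.
(* The map [X -> Hom_A(M, A)] that sends [x] to the [j]-th map attached to
   [f x]. *)
pose phi j (m : M) (x : X) : A := c j (m <* (f x : B)).
have phiF j : balanced_form (phi j).
  split=> [x m m'|m x x'|a m x|m b x]; rewrite /phi.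
  - by rewrite rscaleDl raddfD.
  - by rewrite raddfD rscaleDr raddfD.
  - by rewrite rscaleZ linearZ_LR.
  - by rewrite -rscaleM linearZ_LR.
have /choice [psi psiP] j : exists g : M -> Y -> A,
    balanced_form g /\ forall m x, g m (i x) = phi j m x.
  by have [g ? ?] := balanced_form_extends fgM' projM' injA i_inj (phiF j); exists g.
have [[tDl tDr tb] tZ tR tU] := tT.
(* With values in the functions on [Y], a single use of the universal
   property handles all [y] at once. *)
pose th n' m : Y -> B := fun y => \sum_j ev (t (n' <* psi j m y) (s j)).
have th_bal : balanced th.
  split=> [m m' x|m x x'|m a x]; apply/funext => y; rewrite /th.
  - rewrite fctE -big_split; apply: eq_bigr => j _.
    by rewrite rscaleDl tDl raddfD.
  - rewrite fctE -big_split; apply: eq_bigr => j _.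
    by case: (psiP j) => [[pD _ _ _] _]; rewrite pD rscaleDr tDl raddfD.
  - apply: eq_bigr => j _.
    by case: (psiP j) => [[_ _ pZ _] _]; rewrite pZ rscaleM.
have [Th [ThE _]] := tU _ th th_bal.
have ThD y : {morph Th^~ y : x x' / x + x'}.
  by move=> x x'; rewrite raddfD.
pose g (y : Y) : B^o := Th u y.
have g_lin : linear g.
  move=> b y y'; rewrite /g.
  have -> : Th u (b *: y + y') = Th u (b *: y) + Th u y'.
    apply: (tensor_ext (g := Th^~ (b *: y + y'))
      (h := fun x => Th x (b *: y) + Th x y') tT) => // [x x'|n' m].
      by rewrite !ThD addrACA.
    rewrite !ThE /th -big_split; apply: eq_bigr => j _.
    by case: (psiP j) => [[_ pD _ _] _]; rewrite pD rscaleDr tDl raddfD.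
  congr (_ + _).
  (* On pure tensors, [b] moves from [y] to [m], since [psi j] is balanced;
     the resulting right multiplication by [b] agrees at [u] with the left one,
     for which [Th] is linear. *)
  transitivity (Th (u <* b) y).
    symmetry; apply: (tensor_ext (g := fun x => Th (x <* b) y)
      (h := Th^~ (b *: y)) tT) => // [x x'|n' m].
      by rewrite rscaleDl ThD.
    rewrite -tR !ThE; apply: eq_bigr => j _.
    by case: (psiP j) => [[_ _ _ pb] _]; rewrite pb.
  rewrite -cu.
  apply: (tensor_ext (g := fun x => Th (b *: x) y)
      (h := fun x => b * Th x y) tT) => // [x x'|x x'|n' m].
  - by rewrite scalerDr ThD.
  - by rewrite ThD mulrDr.
  rewrite -tZ !ThE /th mulr_sumr; apply: eq_bigr => j _.
  by rewrite rscaleZ tZ linearZ_LR.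
pose gL : {linear Y -> B^o} :=
  HB.pack g (GRing.isLinear.Build B Y B^o *:%R g g_lin).
exists gL => x.
change (Th u (i x) = f x).
(* At [i x] the map [Th] is [z |-> ev z * f x]. *)
transitivity ((ev u : B) * (f x : B)); last by rewrite evu mul1r.
apply: (tensor_ext (g := Th^~ (i x)) (h := fun z => (ev z : B) * (f x : B)) tT).
- by [].
- by move=> z z'; rewrite raddfD mulrDl.
move=> n' m; rewrite ThE /th.
have -> : (ev (t n' m) : B) * (f x : B) = ev (t n' (m <* (f x : B))).
  by rewrite tR evR.
rewrite [m <* _]sc (additive_sum (tDr n')) raddf_sum.
by apply: eq_bigr => j _; case: (psiP j) => _ ->; rewrite -tb.
Qed.

Theorem propositionA1 (k : fieldType) (A B : falgType k)
    (M : bimodType A B) (N : bimodType B A) :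
  infinite_gldim A -> infinite_gldim B ->
  singular_equivalence_Morita M N ->
  selfinjective A -> selfinjective B.
Proof.
move=> _ _ [[fgM projM fgM' projM'] _ _ [Q [[T [t [tT [F [FR [G FK GK]]]]]] _ _]]].
(* [ev] is [F] followed by the projection to [B], and [u] is [F^-1 (1, 0)]. *)
pose ev (x : T) : B^o := (F x).1.
have ev_lin : linear ev by move=> b x y; rewrite /ev linearP.
pose evL : {linear T -> B^o} :=
  HB.pack ev (GRing.isLinear.Build B T B^o *:%R ev ev_lin).
apply: (@selfinjective_of_split_evaluation k A B M N T t evL (G (1, 0))) => //.
- by move=> x b; rewrite /= /ev FR.
- by rewrite /= /ev GK.
- move=> b; apply: (can_inj FK); rewrite linearZ_LR FR GK.
  congr (_, _) => /=.
    by rewrite -[LHS]/(b * 1) -[RHS]/(1 * b) mulr1 mul1r.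
  rewrite scaler0; apply: (addrI ((0 : Q) <* b)).
  by rewrite -rscaleDl !addr0.
Qed.
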